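(* Suppose that for each $\mathbf p\in[0,1]^N$ and each $x\in E$ the set of maximizers $\arg\max_{q\in[0,1]}K(x,q,\mathbf p)$ is an interval (possibly a single point). Then the set-valued mapping $\Gamma$ has a fixed point, i.e. there is $\hat{\mathbf p}\in[0,1]^N$ with $\hat{\mathbf p}\in\Gamma(\hat{\mathbf p})$, and an equilibrium exists.
   Context: Setting: $E$ is a finite set with $N$ elements and $X=(X_n)_{n\in\mathbb N_0}$ is a time-homogeneous Markov chain on $E$; under $\mathbb P_x$ (expectation $\mathbb E_x$) one has $X_0=x$ a.s. The chain is absorbing: from every $x\in E$ some absorbing state is reached with positive probability in finitely many steps. $(Y_n)_{n\in\mathbb N_0}$ are i.i.d. uniform on $[0,1]$ and independent of $X$. $f,h:E\to\mathbb R$ are functions and $g:\mathbb R\to\mathbb R$ is continuous. Vectors in $\mathbb R^N$ are identified with functions on $E$: $\mathbf p=(p_x)_{x\in E}$. A (mixed) stopping strategy is a vector $\mathbf p\in[0,1]^N$; its stopping time is $\tau_{\mathbf p}=\min\{n\ge0: Y_n\le p_{X_n}\}$ ($=\infty$ if there is no such $n$). Convention: on $\{\tau=\infty\}$, $f(X_\tau):=\lim_{n\to\infty}f(X_n)$ and $h(X_\tau):=\lim_{n\to\infty}h(X_n)$ (the limits exist a.s. because $X$ is absorbing). Notation: $\phi_{\mathbf p}(x)=\mathbb E_x(f(X_{\tau_{\mathbf p}}))$, $\psi_{\mathbf p}(x)=\mathbb E_x(h(X_{\tau_{\mathbf p}}))$, $J_{\mathbf p}(x)=\phi_{\mathbf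 p}(x)+g(\psi_{\mathbf p}(x))$, and $$K(x,q,\mathbf p)=q f(x)+(1-q)\mathbb E_x(\phi_{\mathbf p}(X_1))+g\big(q h(x)+(1-q)\mathbb E_x(\psi_{\mathbf p}(X_1))\big).$$ A stopping strategy $\hat{\mathbf p}$ is an equilibrium if $J_{\hat{\mathbf p}}(x)\ge K(x,q,\hat{\mathbf p})$ for all $q\in[0,1]$ and all $x\in E$. The mapping $\Gamma:[0,1]^N\to2^{[0,1]^N}$ is defined by letting $\Gamma(\mathbf p)$ be the set of all vectors $\mathbf p^*\in[0,1]^N$ with $p^*_x\in\arg\max_{q\in[0,1]}K(x,q,\mathbf p)$ for each $x\in E$. *)

(* Defs.v *)
From HB Require Import structures.
From mathcomp Require Import all_boot all_order all_algebra.
From mathcomp Require Import all_classical all_reals all_analysis.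
Import Order.TTheory GRing.Theory Num.Theory.
Import numFieldNormedType.Exports.

Set Implicit Arguments.
Unset Strict Implicit.
Unset Printing Implicit Defensive.

Local Open Scope classical_set_scope.
Local Open Scope ring_scope.

Section Independence.
Context d (Omega : measurableType d) (R : realType).
Implicit Types (P : probability Omega R).

(* The sigma-algebra on Omega generated by a sequence of maps into a space
   whose measurable sets are the members of [M]. *)
Definition sigma_of_process T (M : set (set T)) (Z : nat -> Omega -> T) :
    set (set Omega) :=
  <<s [set B | exists n A, M A /\ B = Z n @^-1` A] >>.

Definition independent_sigma P (F G : set (set Omega)) : Prop :=
  forall A B, F A -> G B -> P (A `&` B) = (P A * P B)%E.

Definition mutually_independent P (Y : nat -> {mfun Omega >-> R}) : Prop :=
  forall (J : seq nat) (B : nat -> set R), uniq J ->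
    (forall n, measurable (B n)) ->
    P (\bigcap_(n in [set` J]) (Y n @^-1` B n)) =
    (\prod_(n <- J) P (Y n @^-1` B n))%E.

Definition iid_uniform01 P (Y : nat -> {mfun Omega >-> R}) : Prop :=
  mutually_independent P Y /\
  forall n (B : set R), measurable B ->
    distribution P (Y n) B = uniform_prob (@ltr01 R) B.

End Independence.

Section AbsorbingChain.
Context d (Omega : measurableType d) (R : realType) (E : finType).
Variables (Pr : E -> probability Omega R) (X : nat -> Omega -> E).

(* The one-step transition probability from y to z is Pr y (X_1 = z); using
   the same one at every time n and under every Pr x is time-homogeneity. *)
Definition is_markov_chain : Prop :=
  [/\ forall n (A : set E), measurable (X n @^-1` A),
      forall x, Pr x (X 0%N @^-1` [set x]) = 1%E &
      forall x n (s : nat -> E),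
        Pr x [set w | forall i, (i <= n.+1)%N -> X i w = s i] =
        (Pr x [set w | forall i, (i <= n)%N -> X i w = s i] *
         Pr (s n) (X 1%N @^-1` [set s n.+1]))%E].

Definition absorbing_state (a : E) : Prop :=
  Pr a (X 1%N @^-1` [set a]) = 1%E.

Definition is_absorbing_chain : Prop :=
  forall x, exists a n,
    absorbing_state a /\ (0 < Pr x (X n @^-1` [set a]))%E.

End AbsorbingChain.

Section Stopping.
Context d (Omega : measurableType d) (R : realType) (E : finType).
Variables (Pr : E -> probability Omega R) (X : nat -> Omega -> E)
  (Y : nat -> {mfun Omega >-> R}) (f h : E -> R) (g : R -> R).
Implicit Types (p : E -> R) (u : E -> R).

Definition strategy : set (E -> R) := [set p | forall x, 0 <= p x <= 1].

(* [None] stands for an infinite stopping time. *)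
Definition stopping_time p (w : Omega) : option nat :=
  if pselect (exists n, Y n w <= p (X n w)) is left ex
  then Some (ex_minn ex) else None.

Definition stopped_value u p (w : Omega) : R :=
  if stopping_time p w is Some n then u (X n w)
  else limn (fun n => u (X n w)).

(* Expectations are extended reals in the library; all those taken below are
   of bounded random variables, so that [fine] loses nothing. *)
Definition expect_from (x : E) (Z : Omega -> R) : R := fine ('E_(Pr x)[Z])%E.

Definition stopped_mean u p (x : E) : R := expect_from x (stopped_value u p).

Definition phi p : E -> R := stopped_mean f p.
Definition psi p : E -> R := stopped_mean h p.

Definition J p (x : E) : R := phi p x + g (psi p x).

Definition K (x : E) (q : R) p : R :=
  q * f x + (1 - q) * expect_from x (fun w => phi p (X 1%N w)) +
  g (q * h x + (1 - q) * expect_from x (fun w => psi p (X 1%N w))).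

Definition equilibrium p : Prop :=
  strategy p /\ forall q x, 0 <= q <= 1 -> K x q p <= J p x.

Definition argmax01 (F : R -> R) : set R :=
  [set q | 0 <= q <= 1 /\ forall r, 0 <= r <= 1 -> F r <= F q].

Definition Gamma p : set (E -> R) :=
  [set p' | strategy p' /\ forall x, argmax01 (fun q => K x q p) (p' x)].

End Stopping.

(* Main.v *)
(** No general fixed-point theorem is needed.  Label the points of a grid on
    [0,1]^E by [a_i = 0] or [a_i = 1] according to whether some maximizer of
    [K(i, ., p)] lies above [p_i] or all of them lie below; Kuhn's cube lemma
    gives a small cube on which every label takes both values.  Refining the
    grid along an ultrafilter yields a limit [p] at which, for every [i], the
    closed interval of maximizers has points on both sides of [p_i], hence
    contains [p_i].  Kuhn's lemma itself is Stokes' theorem mod 2: the cup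
    product of the coboundaries of the labels sums to 1 over the grid.

    The graph of the maximizers is closed because [phi_p] is continuous in
    [p].  One-step analysis gives [phi_p = p f + (1 - p) T phi_p], with [T] the
    transition operator and [phi_p = f] on absorbing states; any limit of such
    solutions solves the limit equation, whose solution is unique by the
    maximum principle, even when [p] vanishes.  The same equation reads
    [J_p(x) = K(x, p_x, p)], so that a fixed point is an equilibrium. *)
Require Import Defs.
From HB Require Import structures.
From mathcomp Require Import all_boot all_order all_algebra.
From mathcomp Require Import all_classical all_reals all_analysis.
From mathcomp Require Import measurable_realfun.
Import Order.TTheory GRing.Theory Num.Theory.
Import numFieldNormedType.Exports.

Set Implicit Arguments.
Unset Strict Implicit.
Unset Printing Implicit Defensive.

Local Open Scope classical_set_scope.
Local Open Scope ring_scope.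

(** * Kuhn's cube lemma *)

Section KuhnCube.
Variable E : finType.
Implicit Types (z : E -> nat) (F : (E -> nat) -> 'F_2) (S : {set E}).
Implicit Types (s t : seq E).

Definition upd {T : eqType} {U : Type} (z : T -> U) i k : T -> U :=
  fun j => if j == i then k else z j.

Lemma updC {T : eqType} {U : Type} (z : T -> U) i j (k l : U) : i != j ->
  upd (upd z i k) j l = upd (upd z j l) i k.
Proof.
move=> ij; apply/funext => e; rewrite /upd; case: eqP => // ->.
by rewrite eq_sym (negbTE ij).
Qed.

Lemma addFF (x : 'F_2) : x + x = 0.
Proof. by apply: addrr_pchar2; exact: pchar_Fp. Qed.

(** This is the product rule for finite differences: [u] and [x] stand for the values of two
    functions at the shifted point, [v] and [y] for those at the base point. *)
Lemma leibniz_char2 (u v x y : 'F_2) :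
  u * x + v * y = (u + v) * x + v * (x + y).
Proof.
by rewrite mulrDl mulrDr -addrA; congr (_ + _); rewrite addrA addFF add0r.
Qed.

Definition shift z i := upd z i (z i).+1.

Lemma shiftC z i j : shift (shift z i) j = shift (shift z j) i.
Proof.
apply/funext => e; rewrite /shift /upd; case: (eqVneq i j) => [->//|ij].
by case: eqP => // ->; rewrite eq_sym (negbTE ij).
Qed.

Definition diff i F z := F (shift z i) + F z.

(** Each unordered pair contributes twice and so cancels modulo 2; [r] selects one order of each
    pair by rank. *)
Lemma sum_sym_char2 S (f : E -> E -> 'F_2) : (forall i j, f i j = f j i) ->
  \sum_(i in S) \sum_(j in S :\ i) f i j = 0.
Proof.
move=> fC; pose r (i j : E) := (enum_rank i < enum_rank j)%N.
transitivity (\sum_(i in S) \sum_(j in S | r i j) f i j +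
              \sum_(i in S) \sum_(j in S | r j i) f i j).
  rewrite -big_split /=; apply: eq_bigr => i iS.
  rewrite (bigID (fun j => r i j)) /=; congr (_ + _); apply: eq_bigl => j;
    rewrite !inE /r.
    by have [->|] := eqVneq j i; rewrite ?ltnn ?andbF.
  rewrite -leqNgt ltn_neqAle (inj_eq (@ord_inj _)) (inj_eq enum_rank_inj).
  by case: (j \in S); rewrite ?andbT ?andbF.
rewrite [X in _ + X](exchange_big_dep (mem S)) /=; last by move=> i j _ /andP[].
rewrite -[X in X + _]addr0.
rewrite -[X in _ = X](addFF (\sum_(i in S) \sum_(j in S | r i j) f i j)).
rewrite addr0; congr (_ + _); apply: eq_bigr => i iS.
by apply: eq_big => [j|j _]; rewrite ?iS.
Qed.

(** * Products of coboundaries on a cube *)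

Variable a : E -> (E -> nat) -> 'F_2.

(* The cup product of the coboundaries [diff _ (a i)], [i] in [s], on the cube
   with lowest vertex [z] and edge directions [S], modulo 2. *)
Fixpoint cup s S z : 'F_2 :=
  if s is i0 :: s' then
    \sum_(i in S) diff i (a i0) z * cup s' (S :\ i) (shift z i)
  else 1.

(** A product of coboundaries is closed. The product rule splits each difference in two: the terms
    with a second difference of [a i0] are symmetric in the two directions and cancel in pairs; the
    others regroup, for each fixed [j], into a sum that the induction hypothesis kills. *)
Lemma cup_cocycle s S z : \sum_(i in S) diff i (cup s (S :\ i)) z = 0.
Proof.
elim: s S z => [|i0 s IH] S z; first by apply: big1 => i _; rewrite /diff addFF.
pose C i j := cup s (S :\ i :\ j).
have CC i j : C i j = C j i by rewrite /C !finset.setDDl finset.setUC.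
transitivity (\sum_(i in S) \sum_(j in S :\ i)
    (diff j (a i0) (shift z i) + diff j (a i0) z) * C i j (shift (shift z i) j) +
  \sum_(i in S) \sum_(j in S :\ i)
    diff j (a i0) z * diff i (C i j) (shift z j)).
  rewrite -big_split /=; apply: eq_bigr => i iS.
  rewrite /diff /= -!big_split /=; apply: eq_bigr => j jS.
  rewrite -/(C i j) (shiftC z j i) -/(diff j (a i0) (shift z i)) -/(diff j (a i0) z).
  exact: leibniz_char2.
rewrite sum_sym_char2 ?add0r => [|i j]; last first.
  rewrite CC (shiftC z i j); congr (_ * _).
  rewrite /diff (shiftC z i j) -!addrA; congr (_ + _).
  by rewrite addrCA.
rewrite (exchange_big_dep (mem S)) /=; last by move=> i j _; rewrite inE => /andP[].
apply: big1 => j jS.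
transitivity (diff j (a i0) z *
    \sum_(i in S :\ j) diff i (cup s (S :\ j :\ i)) (shift z j)).
  rewrite mulr_sumr; apply: eq_big => [i|i _].
    by rewrite !inE jS andbT eq_sym andbC.
  by rewrite CC.
by rewrite IH mulr0.
Qed.

(** By the product rule, the coboundary of [a i0] times the remaining product is the whole product
    plus a term that vanishes because the remaining product is closed. *)
Lemma cup_exact i0 s S z : cup (i0 :: s) S z =
  \sum_(i in S) diff i (fun z => a i0 z * cup s (S :\ i) z) z.
Proof.
transitivity (\sum_(i in S) diff i (a i0) z * cup s (S :\ i) (shift z i) +
              a i0 z * \sum_(i in S) diff i (cup s (S :\ i)) z).
  by rewrite cup_cocycle mulr0 addr0.
rewrite mulr_sumr -big_split /=; apply: eq_bigr => i _.
exact/esym/leibniz_char2.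
Qed.

(** As [i] is not a direction of the cube, the cube stays in the face where coordinate [i] is [c];
    there [a i] is constant, so its differences, one of the factors, vanish. *)
Lemma cup_face s S i c z (b : 'F_2) : i \in s -> i \notin S ->
  (forall z, z i = c -> a i z = b) -> z i = c -> cup s S z = 0.
Proof.
move=> + + ab; elim: s S z => [//|i0 s IH] S z; rewrite inE => is0 iS zi.
rewrite /=; apply: big1 => j jS.
have ij : (i == j) = false by apply/negP => /eqP ij; rewrite ij jS in iS.
have sz : shift z j i = c by rewrite /shift /upd ij.
have [ii0|ii0] := eqVneq i i0.
  by rewrite /diff -ii0 !ab// addFF mul0r.
rewrite (negbTE ii0) in is0.
by rewrite IH ?mulr0// !inE (negbTE iS) andbF.
Qed.

(** * Summation over the grid and Stokes' formula *)

Variable m : nat.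

Definition sumdir i F z := \sum_(k < m) F (upd z i k).
Definition sumdirs t F := foldr sumdir F t.

Lemma sumdirC i j F : sumdir i (sumdir j F) = sumdir j (sumdir i F).
Proof.
have [->//|ij] := eqVneq i j; apply/funext => z.
rewrite /sumdir exchange_big /=; apply: eq_bigr => k _; apply: eq_bigr => l _.
by rewrite updC.
Qed.

(** The sums commute, so any direction can be made the innermost one, where telescoping applies. *)
Lemma sumdirs_rem i t F : i \in t ->
  sumdirs t F = sumdirs (rem i t) (sumdir i F).
Proof.
elim: t => //= j t IH; rewrite inE eq_sym.
have [->/= _|ij /=] := eqVneq j i.
  elim: t {IH} => //= k t IH.
  by rewrite sumdirC IH.
by move=> /IH ->.
Qed.

Lemma sumdirs_sum t S (G : E -> (E -> nat) -> 'F_2) z :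
  sumdirs t (fun z => \sum_(i in S) G i z) z =
  \sum_(i in S) sumdirs t (G i) z.
Proof.
elim: t z => //= j t IH z; rewrite /sumdir exchange_big /=.
by apply: eq_bigr => k _; rewrite IH.
Qed.

Lemma sumdirs0 t z : sumdirs t (fun=> 0) z = 0.
Proof. by elim: t z => //= j t IH z; rewrite /sumdir big1. Qed.

(** The sum telescopes: interior values occur twice and cancel modulo 2. *)
Lemma sumdir_diff i F z :
  sumdir i (diff i F) z = F (upd z i m) + F (upd z i 0%N).
Proof.
rewrite /sumdir; elim: m => [|n IH]; first by rewrite big_ord0 addFF.
rewrite big_ord_recr /= IH.
have -> : diff i F (upd z i n) = F (upd z i n.+1) + F (upd z i n).
  congr (F _ + _); apply/funext => e.
  by rewrite /shift /upd eqxx; case: eqP.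
by rewrite addrC -addrA; congr (_ + _); rewrite addrA addFF add0r.
Qed.

Lemma sumdirs_upd i t k F z : i \notin t ->
  sumdirs t (fun z => F (upd z i k)) z = sumdirs t F (upd z i k).
Proof.
elim: t z => //= j t IH z; rewrite inE negb_or => /andP[ij it].
by apply: eq_bigr => l _; rewrite IH// updC// eq_sym.
Qed.

Lemma sumdirs_neq0 t F z : sumdirs t F z != 0 ->
  exists2 z', F z' != 0 &
    forall i, (i \in t -> z' i < m)%N /\ (i \notin t -> z' i = z i).
Proof.
elim: t z => [z Fz|j t IH z /=]; first by exists z.
move=> sF; have [k Fk] : exists k : 'I_m, sumdirs t F (upd z j k) != 0.
  apply/existsP; apply: contraNT sF; rewrite negb_exists => /forallP s0.
  by rewrite /sumdir big1// => k _; apply/eqP; rewrite -[_ == _]negbK.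
have [z' Fz' z'P] := IH _ Fk; exists z' => // i; have [zt zn] := z'P i.
rewrite inE negb_or /upd in zn *; split=> [/orP[/eqP ij|/zt//]|/andP[ij it]].
  have [it|it] := boolP (i \in t); first exact: zt.
  by rewrite zn// ij eqxx.
by rewrite zn// (negbTE ij).
Qed.

Hypothesis a0 : forall i z, z i = 0%N -> a i z = 0.
Hypothesis am : forall i z, z i = m -> a i z = 1.

(* Stokes: the product is exact, and of the boundary faces only the one where
   the first label equals 1 survives, the labels of the other directions being
   constant on the faces orthogonal to them. *)
Lemma sum_cup s z : uniq s -> sumdirs s (cup s [set i in s]) z = 1.
Proof.
elim: s z => [//|i0 s IH] z; rewrite cons_uniq => /andP[i0s us].
set S := [set i in i0 :: s].
pose G i := sumdirs (i0 :: s) (diff i (fun z => a i0 z * cup s (S :\ i) z)) z.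
transitivity (\sum_(i in S) G i).
  rewrite /G -sumdirs_sum; congr (sumdirs _ _ _); apply/funext => w.
  exact: cup_exact.
have i0S : i0 \in S by rewrite !inE eqxx.
rewrite (bigD1 i0 i0S) /= [X in _ + X]big1 => [|i].
  rewrite addr0 /G (@sumdirs_rem i0) ?mem_head// [rem _ _]/= eqxx.
  transitivity (sumdirs s (fun z => cup s [set i in s] (upd z i0 m)) z).
    congr (sumdirs _ _ _); apply/funext => w.
    rewrite sumdir_diff am ?a0 /upd ?eqxx//.
    rewrite mul1r mul0r addr0; congr cup; apply/finset.setP => i; rewrite !inE.
    by have [->|] := eqVneq i i0; rewrite ?(negbTE i0s).
  by rewrite sumdirs_upd// IH.
move=> /andP[iS ii0]; have {}iS : i \in S := iS.
have is_ : i \in s by move: iS; rewrite inE in_cons (negbTE ii0).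
rewrite /G (@sumdirs_rem i) ?in_cons ?is_ ?orbT//.
rewrite -[RHS](sumdirs0 (rem i (i0 :: s)) z).
congr (sumdirs _ _ _); apply/funext => w; rewrite sumdir_diff.
rewrite (@cup_face s (S :\ i) i m _ 1) ?(@cup_face s (S :\ i) i 0%N _ 0)
  ?mulr0 ?addr0//.
all: rewrite ?/upd ?inE ?eqxx//; first [exact: a0 | exact: am].
Qed.

(** A nonzero term of the expanded product is a path along edges of the cube, and each label changes
    across one of these edges; [w] is the current vertex, not yet moved in the directions [S]. *)
Lemma cup_neq0 s S w z i : cup s S w != 0 -> i \in s ->
  (forall j, j \in S -> w j = z j) ->
  (forall j, (z j <= w j <= (z j).+1)%N) ->
  exists z1 z2, [/\ forall j, (z j <= z1 j <= (z j).+1)%N,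
    forall j, (z j <= z2 j <= (z j).+1)%N & a i z1 != a i z2].
Proof.
elim: s S w => //= i0 s IH S w cn0; rewrite inE => is_ wS wz.
have [j jS jn0] : exists2 j, j \in S &
    diff j (a i0) w * cup s (S :\ j) (shift w j) != 0.
  apply/exists_inP; apply: contraNT cn0; rewrite negb_exists_in => /forall_inP s0.
  by rewrite big1// => j jS; apply/eqP; rewrite -[_ == _]negbK; exact: s0.
move: jn0; rewrite mulf_eq0 negb_or => /andP[dn0 cn].
have wjz k : (z k <= shift w j k <= (z k).+1)%N.
  by rewrite /shift /upd; case: eqP => [->|_//]; rewrite wS// leqnSn leqnn.
have [ii0|ii0] := eqVneq i i0.
  exists (shift w j), w; split => //; rewrite ii0; apply: contraNneq dn0.
  by rewrite /diff => ->; rewrite addFF.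
rewrite (negbTE ii0) in is_; apply: (IH (S :\ j) (shift w j)) => // k.
by rewrite !inE /shift /upd => /andP[/negbTE -> /wS].
Qed.

End KuhnCube.

(** The grid sum of the products is 1, so some cube has a nonzero product; on it every label changes
    along an edge. *)
Lemma kuhn_cube (E : finType) (m : nat) (a : E -> (E -> nat) -> bool) :
  (forall i z, z i = 0%N -> a i z = false) ->
  (forall i z, z i = m -> a i z = true) ->
  exists2 z : E -> nat, (forall i, z i < m)%N &
    forall i b, exists2 z',
      (forall j, (z j <= z' j <= (z j).+1)%N) & a i z' = b.
Proof.
move=> a0 am; pose c i z : 'F_2 := (a i z)%:R.
have c0 i z : z i = 0%N -> c i z = 0 by rewrite /c => /a0 ->.
have cm i z : z i = m -> c i z = 1 by rewrite /c => /am ->.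
have := @sum_cup E c m c0 cm (enum E) (fun=> 0%N) (enum_uniq E).
move=> /eqP; rewrite -subr_eq0 => /eqP s1.
have /sumdirs_neq0[z zn0 zP] :
    sumdirs m (enum E) (cup c (enum E) [set i in enum E]) (fun=> 0%N) != 0.
  by rewrite -[X in X != _](subrK 1) s1 add0r oner_eq0.
exists z => [i|i b]; first by have [+ _] := zP i; rewrite mem_enum => ->.
have [|||z1 [z2 [z1P z2P z12]]] := @cup_neq0 _ _ _ _ _ z i zn0.
- by rewrite mem_enum.
- by [].
- by move=> j; rewrite leqnn leqnSn.
have [z1b|z1b] := eqVneq (a i z1) b; first by exists z1.
exists z2 => //; move: z12 z1b; rewrite /c.
by case: (a i z1); case: (a i z2); case: b.
Qed.

(** * Absorbing Markov chains *)

Lemma cvg_sumr {T : Type} {R : realType} {I : Type} (F : set_system T)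
    {FF : Filter F} (r : seq I) (f : I -> T -> R) (l : I -> R) :
  (forall i, f i @ F --> l i) ->
  (fun t => \sum_(i <- r) f i t) @ F --> \sum_(i <- r) l i.
Proof.
move=> fl; elim: r => [|i r IH].
  rewrite big_nil (_ : (fun _ => _) = cst 0); first exact: cvg_cst.
  by apply/funext => t; rewrite big_nil.
rewrite big_cons (_ : (fun _ => _) = f i \+ (fun t => \sum_(j <- r) f j t)).
  by apply: cvgD => //; exact: fl.
by apply/funext => t; rewrite big_cons.
Qed.

Section Chain.
Context d (Omega : measurableType d) (R : realType) (E : finType).
Variables (Pr : E -> probability Omega R) (X : nat -> Omega -> E).
Hypothesis markovX : is_markov_chain Pr X.

Definition pr x (A : set Omega) : R := fine (Pr x A).

Lemma prE x A : measurable A -> Pr x A = (pr x A)%:E.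
Proof. by move=> mA; rewrite /pr fineK// fin_num_measure. Qed.

Lemma pr_ge0 x A : 0 <= pr x A.
Proof. exact: fine_ge0. Qed.

Lemma pr_setT x : pr x setT = 1.
Proof. by rewrite /pr probability_setT. Qed.

Lemma pr0_negligible x A : measurable A -> pr x A = 0 ->
  (Pr x).-negligible A.
Proof.
move=> mA A0; apply/negligibleP => //.
by transitivity (pr x A)%:E; [exact: prE|rewrite A0].
Qed.

Definition trans (x y : E) : R := pr x (X 1%N @^-1` [set y]).

Lemma measurable_state n (A : set E) : measurable (X n @^-1` A).
Proof. by case: markovX. Qed.

Lemma pr_split x n A : measurable A ->
  pr x A = \sum_(z : E) pr x (A `&` X n @^-1` [set z]).
Proof.
move=> mA; rewrite /pr sum_fine => [|z _]; last first.
  by rewrite fin_num_measure//; apply: measurableI => //; exact: measurable_state.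
congr fine; rewrite -big_enum /=.
rewrite fsbig_seq ?enum_uniq// -measure_fin_bigcup//=.
- congr (Pr x _); apply/seteqP; split => [w Aw|w [z _ []]//].
  by exists (X n w) => //=; rewrite mem_enum.
- by move=> i j _ _ [w [[_ <-] [_ <-]]].
- by move=> z _; apply: measurableI => //; exact: measurable_state.
Qed.

Lemma trans_ge0 x y : 0 <= trans x y. Proof. exact: pr_ge0. Qed.

Lemma sum_trans x : \sum_y trans x y = 1.
Proof.
rewrite -(pr_setT x) (@pr_split x 1%N)//.
by apply: eq_bigr => y _; rewrite setTI.
Qed.

(** * Probabilities of events along paths *)

Definition cylinder n (s : nat -> E) : set Omega :=
  [set w | forall i, (i <= n)%N -> X i w = s i].

Lemma cylinderE n s :
  cylinder n s = \bigcap_(i in `I_n.+1) (X i @^-1` [set s i]).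
Proof. by []. Qed.

Lemma measurable_cylinder n s : measurable (cylinder n s).
Proof.
rewrite cylinderE; apply: bigcap_measurableType => i _.
exact: measurable_state.
Qed.

Lemma pr_cylinderS x n s :
  pr x (cylinder n.+1 s) = pr x (cylinder n s) * trans (s n) (s n.+1).
Proof.
have [_ _ /(_ x n s) mk] := markovX; rewrite /pr mk.
rewrite fineM// fin_num_measure//; first exact: measurable_cylinder.
exact: measurable_state.
Qed.

(** For [c = 1] this is the transition operator; for [c = 1 - p] it is that of the chain killed in
    each state with probability [p]. *)
Definition weighted_step (c u : E -> R) : E -> R :=
  fun x => c x * \sum_y trans x y * u y.

(* Backward induction on the length of the prescribed initial path. *)
Lemma path_disintegration n (c v : E -> R) D x : measurable D ->
  (forall s, pr x (cylinder n s `&` D) =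
             pr x (cylinder n s) * (\prod_(j < n) c (s j)) * v (s n)) ->
  pr x D = iter n (weighted_step c) v x.
Proof.
move=> mD DE.
have H m k : (k + m = n)%N -> forall s, pr x (cylinder k s `&` D) =
    pr x (cylinder k s) * (\prod_(j < k) c (s j)) * iter m (weighted_step c) v (s k).
  elim: m k => [k|m IH k kmn s]; first by rewrite addn0 => ->.
  have mDk : measurable (cylinder k s `&` D).
    by apply: measurableI => //; exact: measurable_cylinder.
  rewrite (@pr_split x k.+1 _ mDk) /= /weighted_step mulrA mulr_sumr.
  apply: eq_bigr => z _; pose s' := upd s k.+1 z.
  have ss' i : (i <= k)%N -> s' i = s i.
    by move=> ik; rewrite /s' /upd ltn_eqF.
  have s'z : s' k.+1 = z by rewrite /s' /upd eqxx.
  have css' : cylinder k s' = cylinder k s.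
    by apply/seteqP; split=> w ws i ik; rewrite ws// ss'.
  have -> : cylinder k s `&` D `&` X k.+1 @^-1` [set z] = cylinder k.+1 s' `&` D.
    apply/seteqP; split => [w [[ws Dw] wz]|w [ws Dw]].
      split=> // i; rewrite leq_eqVlt => /orP[/eqP ->|]; first by rewrite s'z.
      by rewrite ltnS => ik; rewrite ss'// ws.
    split; last by rewrite /= ws.
    by split=> // i ik; rewrite ws ?ss'// (leq_trans ik).
  rewrite IH ?addSnnS// pr_cylinderS css' s'z ss'// big_ord_recr /= ss'//.
  have -> : \prod_(j < k) c (s' j) = \prod_(j < k) c (s j).
    by apply: eq_bigr => j _; rewrite ss'// ltnW.
  by rewrite -!mulrA; congr (_ * _); rewrite mulrCA; congr (_ * _); rewrite mulrCA.
have m0 := measurable_cylinder 0 (fun=> x).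
have c0 : pr x (cylinder 0 (fun=> x)) = 1.
  rewrite /pr (_ : cylinder _ _ = X 0%N @^-1` [set x]).
    by have [_ -> _] := markovX.
  by apply/seteqP; split => [w /(_ _ (leqnn 0))//|w wx [|i]].
have := H n 0%N erefl (fun=> x); rewrite c0 big_ord0 !mul1r => <-.
(* The chain starts at [x] almost surely, so the part of [D] outside the trivial cylinder is
   null. *)
have nc0 : pr x (D `\` cylinder 0 (fun=> x)) = 0.
  have mC : measurable (~` cylinder 0 (fun=> x)) by exact: measurableC.
  have : (Pr x (D `\` cylinder 0 (fun=> x)) <= Pr x (~` cylinder 0 (fun=> x)))%E.
    by apply: le_measure; rewrite ?inE//; exact: measurableD.
  rewrite probability_setC// (prE x m0) c0 subee// !prE//; last exact: measurableD.
  by rewrite lee_fin => le0; apply/eqP; rewrite eq_le le0 pr_ge0.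
apply: EFin_inj; rewrite -!prE//; last exact: measurableI.
have -> : Pr x D = (Pr x (D `\` cylinder 0 (fun=> x)) +
                   Pr x (D `&` cylinder 0 (fun=> x)))%E.
  exact: measureDI.
rewrite [X in (X + _)%E]prE; last exact: measurableD.
by rewrite nc0 add0e setIC.
Qed.

Lemma step_sum c (u v : E -> R) k x :
  weighted_step c (fun y => k * u y + v y) x =
  k * weighted_step c u x + weighted_step c v x.
Proof.
rewrite /weighted_step mulrCA -mulrDr; congr (_ * _).
rewrite mulr_sumr -big_split /=; apply: eq_bigr => y _.
by rewrite mulrDr mulrCA.
Qed.

Lemma iter_step_sum n c (u v : E -> R) k x :
  iter n (weighted_step c) (fun y => k * u y + v y) x =
  k * iter n (weighted_step c) u x + iter n (weighted_step c) v x.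
Proof.
elim: n x => //= n IH x; rewrite -step_sum.
by congr (weighted_step c _ x); apply/funext.
Qed.

Lemma iter_step_bigsum n c (I : finType) (k : I -> R) (f : I -> E -> R) x :
  iter n (weighted_step c) (fun y => \sum_i k i * f i y) x =
  \sum_i k i * iter n (weighted_step c) (f i) x.
Proof.
elim: n x => // n IH x; rewrite iterS.
transitivity (weighted_step c
  (fun y => \sum_i k i * iter n (weighted_step c) (f i) y) x).
  by congr (weighted_step c _ x); apply/funext.
rewrite /weighted_step; under [RHS]eq_bigr do rewrite mulrCA mulr_sumr.
rewrite -mulr_sumr exchange_big /=; congr (_ * _); apply: eq_bigr => y _.
by rewrite mulr_sumr; apply: eq_bigr => i _; rewrite mulrCA.
Qed.

Lemma ler_step c (u v : E -> R) x : (forall y, 0 <= c y) ->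
  (forall y, u y <= v y) -> weighted_step c u x <= weighted_step c v x.
Proof.
move=> c0 uv; apply: ler_wpM2l => //; apply: ler_sum => y _.
by apply: ler_wpM2l => //; exact: trans_ge0.
Qed.

Lemma ler_iter_step n c (u v : E -> R) x : (forall y, 0 <= c y) ->
  (forall y, u y <= v y) ->
  iter n (weighted_step c) u x <= iter n (weighted_step c) v x.
Proof. by move=> c0 uv; elim: n x => //= n IH x; exact: ler_step. Qed.

Lemma step_cst k x : weighted_step (fun=> 1) (fun=> k) x = k.
Proof. by rewrite /weighted_step mul1r -mulr_suml sum_trans mul1r. Qed.

Lemma iter_step_cst n k x : iter n (weighted_step (fun=> 1)) (fun=> k) x = k.
Proof.
elim: n x => //= n IH x; rewrite -[RHS](step_cst k x).
by congr (weighted_step _ _ x); apply/funext.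
Qed.

Lemma pr_state n x (A : set E) :
  pr x (X n @^-1` A) = iter n (weighted_step (fun=> 1)) \1_A x.
Proof.
apply: path_disintegration => [|s]; first exact: measurable_state.
rewrite big1// mulr1 indicE; have [sA|sA] := boolP (s n \in A).
  rewrite mulr1 (_ : _ `&` _ = cylinder n s)//; apply/setIidl => w ws.
  by rewrite /= ws//; exact: set_mem.
rewrite mulr0 (_ : _ `&` _ = set0) ?/pr ?measure0//.
apply/seteqP; split => // w [ws]; rewrite /= ws// => As.
by rewrite (mem_set As) in sA.
Qed.

(** * Absorption *)

Definition transient : set E := [set y | ~ absorbing_state Pr X y].

Lemma trans_absorbing a y : absorbing_state Pr X a -> trans a y = (y == a)%:R.
Proof.
move=> absa; have taa : trans a a = 1 by rewrite /trans /pr absa.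
case: eqVneq => [->//|ya]; rewrite [RHS](_ : _ = 0)//.
apply/eqP; rewrite eq_le trans_ge0 andbT.
have <- : \sum_(z | z != a) trans a z = 0.
  by apply: (addrI 1); rewrite addr0 -[RHS](sum_trans a) [in RHS](bigD1 a)//= taa.
by rewrite (bigD1 y)//= lerDl sumr_ge0// => i _; exact: trans_ge0.
Qed.

Hypothesis absorbingX : is_absorbing_chain Pr X.

(** From a state [x] maximizing [|u|], the chain is with probability [e > 0] at an absorbing state
    [a] at time [n], where [u] vanishes; hence [|u x| <= (1 - e) * |u x|]. *)
Lemma max_principle (u : E -> R) :
  (forall a, absorbing_state Pr X a -> u a = 0) ->
  (forall x, `|u x| <= \sum_y trans x y * `|u y|) -> forall x, u x = 0.
Proof.
move=> ua uT x0.
have [x _ xmax] := @arg_maxP _ _ _ x0 predT (fun x => `|u x|) isT.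
suff ux : `|u x| <= 0.
  by apply/normr0_eq0/eqP; rewrite eq_le normr_ge0 andbT (le_trans (xmax _ isT)).
have [a [n [absa pa]]] := absorbingX x; have ma := measurable_state n [set a].
have {pa} : 0 < pr x (X n @^-1` [set a]) by rewrite -lte_fin -prE.
rewrite pr_state; set e := iter _ _ _ _ => e0.
have uIter k y : `|u y| <= iter k (weighted_step (fun=> 1)) (fun y => `|u y|) y.
  elim: k y => //= k IH y; rewrite (le_trans (uT y))// -[leLHS]mul1r.
  exact: (@ler_step (fun=> 1) (fun y => `|u y|)).
(* Pointwise, [|u|] is at most [|u x|] times one minus the indicator of [a]; [n] transition steps
   are applied to this bound. *)
have : `|u x| <= - `|u x| * e + `|u x|.
  rewrite (le_trans (uIter n x))// -[X in _ <= _ + X](iter_step_cst n _ x).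
  rewrite /e -iter_step_sum; apply: ler_iter_step => // y.
  rewrite indicE; have [ya|ya] := boolP (y \in [set a]).
    by rewrite (set_mem ya) ua// normr0 mulr1 addNr.
  by rewrite mulr0 add0r; exact: xmax.
rewrite lerDr mulNr oppr_ge0 pmulr_lle0//.
Qed.

(** These probabilities decrease in [n]; their limit is invariant under the transition operator and
    zero on absorbing states, so the maximum principle applies. *)
Lemma cvg_pr_transient x : pr x (X n @^-1` transient) @[n --> \oo] --> 0.
Proof.
pose r n x := pr x (X n @^-1` transient).
have rS n y : r n.+1 y = \sum_z trans y z * r n z.
  rewrite /r pr_state /= /weighted_step mul1r; apply: eq_bigr => z _.
  by rewrite pr_state.
have r_abs n a : absorbing_state Pr X a -> r n a = 0.
  move=> absa; elim: n => [|n IH].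
    by rewrite /r pr_state /= indicE memNset.
  rewrite rS (bigD1 a)//= IH mulr0 add0r big1// => z za.
  by rewrite trans_absorbing// (negbTE za) mul0r.
have r_le n y : r n.+1 y <= r n y.
  elim: n y => [y|n IH y]; last first.
    by rewrite rS [leRHS]rS; apply: ler_sum => z _; rewrite ler_wpM2l// trans_ge0.
  have [absy|ntr] := pselect (absorbing_state Pr X y); first by rewrite !r_abs.
  have -> : r 0%N y = 1 by rewrite /r pr_state /= indicE mem_set.
  by rewrite /r -lee_fin -prE ?probability_le1//; exact: measurable_state.
have r_cvg y : cvgn (r ^~ y).
  apply: nonincreasing_is_cvgn.
    by apply/nonincreasing_seqP => n; exact: r_le.
  by exists 0 => _ [n _ <-]; exact: pr_ge0.
pose l y := limn (r ^~ y).
suff l0 : forall y, l y = 0 by rewrite -(l0 x); exact: r_cvg.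
apply: max_principle => [a absa|y].
  by apply/cvg_lim => //; apply: cvg_near_cst; near=> n; rewrite r_abs.
have lge0 z : 0 <= l z by apply: limr_ge => //; near=> n; exact: pr_ge0.
rewrite ger0_norm// le_eqVlt; apply/orP; left; apply/eqP.
under eq_bigr do rewrite ger0_norm//.
have rl : (fun n => r n.+1 y) @ \oo --> l y.
  by rewrite (cvg_shiftS (r ^~ y)); exact: r_cvg.
rewrite -(cvg_lim (@norm_hausdorff _ R^o) rl); apply/cvg_lim => //.
rewrite (_ : (fun n => _) = fun n => \sum_z trans y z * r n z).
  by apply: cvg_sumr => z; apply: cvgM; [exact: cvg_cst|exact: r_cvg].
by apply/funext => n; exact: rS.
Unshelve. all: by end_near. Qed.

(** Two null events are discarded: never entering an absorbing state, and leaving one at some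
    time. *)
Lemma ae_eventually_constant x :
  {ae Pr x, forall w, exists N, forall n, (N <= n)%N -> X n w = X N w}.
Proof.
pose jump n := [set w | absorbing_state Pr X (X n w) /\ X n.+1 w <> X n w].
have mjump n : measurable (jump n).
  rewrite (_ : jump n = X n @^-1` (~` transient) `\`
      \bigcup_(a in [set: E]) (X n @^-1` [set a] `&` X n.+1 @^-1` [set a])).
    apply: measurableD; first exact: measurable_state.
    apply: fin_bigcup_measurable => // a _.
    by apply: measurableI; exact: measurable_state.
  apply/seteqP; split => w [absw Xw]; split=> //=.
  - by move=> [a _ [/= Xa Xa']]; apply: Xw; rewrite Xa Xa'.
  - exact: contrapT.
  - by move=> XX; apply: Xw; exists (X n w).
have jump0 n : pr x (jump n) = 0.
  rewrite (@path_disintegration n (fun=> 1) (fun=> 0))// => [|s].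
    exact: iter_step_cst.
  rewrite mulr0; have [abss|ntr] := pselect (absorbing_state Pr X (s n)); last first.
    rewrite (_ : _ `&` _ = set0) ?/pr ?measure0//.
    by apply/seteqP; split => // w [ws [/=]]; rewrite ws.
  (* On a path that is absorbed at time [n], the event is the cylinder minus its extension by
     staying put, and these two have equal probability. *)
  pose s' := upd s n.+1 (s n).
  have ss' i : (i <= n)%N -> s' i = s i by move=> ik; rewrite /s' /upd ltn_eqF.
  have mC := measurable_cylinder n s; have mC' := measurable_cylinder n.+1 s'.
  have cs' : cylinder n s' = cylinder n s.
    by apply/seteqP; split=> w ws i ik; rewrite ws// ss'.
  rewrite (_ : _ `&` _ = cylinder n s `\` cylinder n.+1 s'); last first.
    apply/seteqP; split => [w [ws [absw XX]]|w [ws ws']]; split => //.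
      by move=> /(_ _ (leqnn _)); rewrite /s' {1}/upd eqxx -ws.
    split; first by rewrite /= ws.
    move=> XX; apply: ws' => i; rewrite leq_eqVlt => /orP[/eqP ->|].
      by rewrite XX ws// /s' /upd eqxx.
    by rewrite ltnS => ik; rewrite ss'// ws.
  apply: EFin_inj; rewrite -prE; last exact: measurableD.
  have -> : Pr x (cylinder n s `\` cylinder n.+1 s') =
      (Pr x (cylinder n s) - Pr x (cylinder n s `&` cylinder n.+1 s'))%E.
    by apply: measureD => //; rewrite ltey_eq fin_num_measure.
  rewrite (_ : _ `&` _ = cylinder n.+1 s').
    rewrite !prE// pr_cylinderS cs' ss'// /s' /upd eqxx.
    by rewrite trans_absorbing// eqxx mulr1 subee.
  by apply/setIidr => w ws i ik; rewrite ws ?ss'// (leq_trans ik).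
(* Being transient for ever is contained in being transient at time [n], for each [n]. *)
have tr0 : (Pr x).-negligible (\bigcap_n (X n @^-1` transient)).
  have mtr : measurable (\bigcap_n (X n @^-1` transient)).
    by apply: bigcapT_measurable => n; exact: measurable_state.
  apply: pr0_negligible => //; apply/eqP; rewrite eq_le pr_ge0 andbT.
  apply: (cvgr_to_ge (cvg_pr_transient x)); near=> n.
  have mn := measurable_state n transient.
  by rewrite -lee_fin -!prE//; apply: le_measure; rewrite ?inE// => w; exact.
have bad0 : (Pr x).-negligible (\bigcup_n jump n).
  by apply: negligible_bigcup => n; apply: pr0_negligible => //; exact: jump0.
have := negligibleU tr0 bad0; apply: negligibleS => w /=.
apply: contra_notP => /not_orP[ntr nbad].
have [N absN] : exists N, absorbing_state Pr X (X N w).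
  by apply: contra_notP ntr => /forallNP nabs n _; exact: nabs.
exists N; elim=> [|n IH]; first by rewrite leqn0 => /eqP ->.
rewrite leq_eqVlt => /orP[/eqP ->//|]; rewrite ltnS => /IH Xn.
apply: contra_notP nbad => XN; exists n => //; split; first by rewrite Xn.
by rewrite Xn.
Unshelve. all: by end_near. Qed.

End Chain.

(** * One-step analysis of the stopped chain *)

(** The values other than the limit form a finite, hence closed, set; its complement is a
    neighbourhood of the limit and eventually captures the sequence. *)
Lemma cvgn_finite_range {R : realType} {E : finType} (u : E -> R) (x : nat -> E) :
  cvgn (u \o x) -> exists N, forall n, (N <= n)%N -> u (x n) = u (x N).
Proof.
move=> /cvg_ex[l xl].
have [N _ xN] : \forall n \near \oo, u (x n) = l.
  have oA : open (~` (u @` [set y | u y != l])).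
    have acc : accessible_space R^o.
      exact/hausdorff_accessible/norm_hausdorff.
    apply: closed_openC; apply: (proj1 accessible_finite_set_closed acc).
    exact: finite_image.
  have lA : nbhs l (~` (u @` [set y | u y != l])).
    by apply: open_nbhs_nbhs; split => // -[y /eqP].
  have : \forall n \near \oo, (~` (u @` [set y | u y != l])) (u (x n)) := xl _ lA.
  apply: filterS => n /=; apply: contra_notP => /eqP ul.
  by exists (x n).
by exists N => n Nn; rewrite !xN//=.
Qed.

Section StoppedChain.
Context d (Omega : measurableType d) (R : realType) (E : finType).
Variables (Pr : E -> probability Omega R) (X : nat -> Omega -> E).
Variable (Y : nat -> {mfun Omega >-> R}).
Hypothesis markovX : is_markov_chain Pr X.
Hypothesis absorbingX : is_absorbing_chain Pr X.
Hypothesis iidY : forall x, iid_uniform01 (Pr x) Y.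
Hypothesis indepXY : forall x,
  independent_sigma (Pr x)
    (sigma_of_process (setT : set (set E)) X)
    (sigma_of_process (measurable : set (set R)) (fun n => Y n)).

Local Notation pr := (pr Pr).
Local Notation trans := (trans Pr X).
Local Notation step := (weighted_step Pr X).
Local Notation expect_from := (expect_from Pr).

Lemma measurable_preY n (B : set R) : measurable B -> measurable (Y n @^-1` B).
Proof. by move=> mB; rewrite -[_ @^-1` _]setTI; exact: measurable_funP. Qed.

Lemma pr_uniform_le x n q : 0 <= q <= 1 -> pr x (Y n @^-1` `]-oo, q]) = q.
Proof.
move=> /andP[q0 q1]; have [_ /(_ n `]-oo, q]%classic)] := iidY x.
rewrite /distribution /pushforward /= /pr => ->//.
rewrite /uniform_prob integral_uniform_pdf.
rewrite (_ : _ `&` _ = `[0, q]%classic); last first.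
  apply/seteqP; split => r /=; rewrite !in_itv /=.
    by move=> [rq /andP[-> _]].
  by move=> /andP[r0 rq]; rewrite r0 (le_trans rq q1).
rewrite (eq_integral (fun=> 1%:E)) => [|r].
  rewrite integral_cst//= mul1e lebesgue_measure_itv /= lte_fin.
  by move: q0; rewrite le_eqVlt => /orP[/eqP <-|->]; rewrite ?ltxx// oppr0 adde0.
rewrite inE /= in_itv /= => /andP[r0 rq].
by rewrite /uniform_pdf r0 (le_trans rq q1) subr0 invr1.
Qed.

Lemma pr_uniform_gt x n q : 0 <= q <= 1 -> pr x (Y n @^-1` `]q, +oo[) = 1 - q.
Proof.
move=> q01; have mq : measurable (Y n @^-1` `]-oo, q]) by exact: measurable_preY.
apply: EFin_inj; rewrite -setCitvl preimage_setC -prE; last exact: measurableC.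
by rewrite probability_setC// prE// pr_uniform_le.
Qed.

(** First [X] is separated from [Y], then the [Y j] from each other. *)
Lemma pr_cylinder_indep x n s (B : nat -> set R) : (forall j, measurable (B j)) ->
  pr x (cylinder X n s `&` \bigcap_(j in `I_n.+1) (Y j @^-1` B j)) =
  pr x (cylinder X n s) * \prod_(j < n.+1) pr x (Y j @^-1` B j).
Proof.
move=> mB; rewrite {1}/pr indepXY; first last.
(* Both events are intersections of generators, hence members of the generated sigma-algebras. *)
- apply: (@bigcap_measurableType _ (g_sigma_algebraType
    [set B | exists n A, measurable A /\ B = Y n @^-1` A])) => j _.
  by apply: sub_sigma_algebra; exists j, (B j).
- rewrite cylinderE; apply: (@bigcap_measurableType _ (g_sigma_algebraType
    [set B | exists n A, (setT : set (set E)) A /\ B = X n @^-1` A])) => j _.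
  by apply: sub_sigma_algebra; exists j, [set s j].
have [indY _] := iidY x.
have -> : \bigcap_(j in `I_n.+1) (Y j @^-1` B j) =
          \bigcap_(j in [set` iota 0 n.+1]) (Y j @^-1` B j).
  apply/seteqP; split => w Yw j jn; apply: Yw.
    by have : j \in iota 0 n.+1 := jn; rewrite mem_iota.
  by change (is_true (j \in iota 0 n.+1)); rewrite mem_iota.
rewrite indY ?iota_uniq// (eq_bigr (fun j => (pr x (Y j @^-1` B j))%:E)); last first.
  by move=> j _; apply: prE; exact: measurable_preY.
rewrite prodEFin [X in (X * _)%E]prE; last exact: (measurable_cylinder markovX).
rewrite -EFinM; congr (_ * _).
by have := big_mkord xpredT (fun j => pr x (Y j @^-1` B j)) (n := n.+1);
  rewrite /index_iota subn0.
Qed.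

Variable p : E -> R.
Hypothesis p01 : strategy p.

Definition survives n : set Omega :=
  [set w | forall j, (j < n)%N -> p (X j w) < Y j w].

Let p01' x : 0 <= p x <= 1. Proof. exact: p01. Qed.

Lemma onem_p_ge0 x : 0 <= 1 - p x.
Proof. by rewrite subr_ge0; have /andP[] := p01' x. Qed.

Lemma measurable_survives n : measurable (survives n).
Proof.
rewrite (_ : survives n = \bigcap_(j in `I_n)
   \bigcup_(z in [set: E]) (X j @^-1` [set z] `&` Y j @^-1` `]p z, +oo[)).
  apply: bigcap_measurableType => j _; apply: fin_bigcup_measurable => // z _.
  apply: measurableI; first exact: (measurable_state markovX).
  exact: measurable_preY.
apply/seteqP; split => w sw j jn.
  by exists (X j w) => //; split=> //=; rewrite in_itv /= andbT sw.
by have [z _ [/= <-]] := sw j jn; rewrite in_itv /= andbT.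
Qed.

(** Surviving time [j] costs a factor [1 - p (X j)], absorbed into the transition operator; the draw
    at time [n] contributes the factor [v]. *)
Lemma pr_survives x n y (B : set R) v : measurable B ->
  (forall x, pr x (Y n @^-1` B) = v) ->
  pr x (X n @^-1` [set y] `&` survives n `&` Y n @^-1` B) =
  iter n (step (fun z => 1 - p z)) (fun z => v * \1_[set y] z) x.
Proof.
move=> mB Bv; apply: (path_disintegration markovX) => [|s].
  apply: measurableI; last exact: measurable_preY.
  apply: measurableI; first exact: (measurable_state markovX).
  exact: measurable_survives.
rewrite indicE; have [sy|sy] := boolP (s n \in [set y]); last first.
  rewrite mulr0 mulr0 (_ : _ `&` _ = set0) ?/pr ?measure0//.
  apply/seteqP; split => // w [ws [[Xy _] _]]; case/negP: sy.
  by apply: mem_set; rewrite /= -ws.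
(* On a fixed path the thresholds are constants, so survival and the last draw become conditions on
   the individual [Y j]. *)
pose C j := if (j < n)%N then `]p (s j), +oo[%classic else B.
have -> : cylinder X n s `&` (X n @^-1` [set y] `&` survives n `&` Y n @^-1` B) =
    cylinder X n s `&` \bigcap_(j in `I_n.+1) (Y j @^-1` C j).
  apply/seteqP; split => w [ws].
    move=> [[Xn sw] YB]; split=> // j; rewrite /= /C ltnS => jn.
    case: ifPn => [jn'|]; first by rewrite /= in_itv /= andbT -ws// sw.
    by rewrite -leqNgt => nj; rewrite (@anti_leq j n) ?jn ?nj.
  move=> wC; split=> //; split; last by have := wC n (ltnSn n); rewrite /= /C ltnn.
  split; first by rewrite /= ws//; exact: set_mem.
  move=> j jn; have := wC j (ltnW jn); rewrite /= /C jn /= in_itv /= andbT.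
  by rewrite ws// ltnW.
rewrite pr_cylinder_indep => [|j]; last by rewrite /C; case: ifP.
rewrite big_ord_recr /= {2}/C ltnn Bv mulr1 mulrA; congr (_ * _ * _).
by apply: eq_bigr => j _; rewrite /C ltn_ord pr_uniform_gt.
Qed.

(** * The stopping time truncated at [n] *)

Definition stop_upto n (w : Omega) : nat :=
  if stopping_time X Y p w is Some k then minn k n else n.

(** For [k <= n] this is the event of stopping at [k] when stopping is forced at [n]; hence no
    condition on the draw when [k = n]. *)
Definition stopped_at n k : set Omega :=
  survives k `&` [set w | (k < n)%N -> Y k w <= p (X k w)].

Lemma stopped_atE n k w : (k <= n)%N ->
  stopped_at n k w <-> k = stop_upto n w.
Proof.
rewrite /stop_upto /stopping_time /stopped_at /survives /= => kn.
case: pselect => [ex|nex].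
  case: ex_minnP => k0 Yk0 k0min; split=> [[sk Yk]|ke].
    have k0k : (k <= k0)%N.
      by rewrite leqNgt; apply/negP => /sk; rewrite ltNge Yk0.
    move: kn; rewrite leq_eqVlt => /orP[/eqP kn|kn].
      by rewrite -kn; apply/esym/minn_idPr.
    have kk0 : k = k0 by apply/eqP; rewrite eqn_leq k0k k0min// Yk.
    by apply/esym; rewrite kk0; apply/minn_idPl; rewrite -kk0 ltnW.
  split=> [j jk|kn'].
    rewrite ltNge; apply/negP => /k0min; rewrite leqNgt => /negP; apply.
    by rewrite (leq_trans jk)// ke geq_minl.
  by move: ke kn'; have [_ -> //|_ ->] := leqP k0 n; rewrite ltnn.
split=> [[sk Yk]|->].
  apply/eqP; rewrite eqn_leq kn leqNgt; apply/negP => /Yk Yk'.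
  by apply: nex; exists k.
split=> [j _|]; last by rewrite ltnn.
by rewrite ltNge; apply/negP => Yj; apply: nex; exists j.
Qed.

Let stop_prob n k y : R := if (k < n)%N then p y else 1.

Lemma stopped_at_state n k y :
  X k @^-1` [set y] `&` stopped_at n k = X k @^-1` [set y] `&` survives k `&`
    Y k @^-1` (if (k < n)%N then `]-oo, p y]%classic else setT).
Proof.
rewrite setIA; apply/seteqP; split => w [[/= <- sw] Yw]; split=> //=.
  by move: Yw; case: ifP => //= _ /(_ isT); rewrite in_itv.
by move: Yw; case: ifP => //=; rewrite in_itv.
Qed.

Lemma measurable_stopped_at n k y :
  measurable (X k @^-1` [set y] `&` stopped_at n k).
Proof.
rewrite stopped_at_state; apply: measurableI.
  apply: measurableI; last exact: measurable_survives.
  exact: (measurable_state markovX).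
by apply: measurable_preY; case: ifP.
Qed.

Lemma pr_stopped_at x n k y :
  pr x (X k @^-1` [set y] `&` stopped_at n k) =
  iter k (step (fun z => 1 - p z)) (fun z => stop_prob n k z * \1_[set y] z) x.
Proof.
rewrite stopped_at_state (@pr_survives x k y _ (stop_prob n k y)).
- congr (iter _ _ _ x); apply/funext => z; rewrite indicE.
  by have [/set_mem ->//|_] := boolP (z \in [set y]); rewrite !mulr0.
- by case: ifP.
- move=> z; rewrite /stop_prob; case: ifP => _; first exact: pr_uniform_le.
  by rewrite preimage_setT; exact: pr_setT.
Qed.

Variable u : E -> R.

Definition stopped_value_upto n (w : Omega) : R := u (X (stop_upto n w) w).

(** Splitting by the truncated time and the state at that time reduces measurability and expectation
    to events of known probability. *)
Lemma stopped_value_uptoE n w : stopped_value_upto n w =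
  \sum_(ky : 'I_n.+1 * E)
     u ky.2 * \1_(X ky.1 @^-1` [set ky.2] `&` stopped_at n ky.1) w.
Proof.
have sn : (stop_upto n w < n.+1)%N.
  by rewrite ltnS /stop_upto; case: stopping_time => // k; exact: geq_minr.
rewrite (bigD1 (Ordinal sn, X (stop_upto n w) w)) //= big1 => [|[k y] /= kyn].
  by rewrite addr0 indicE mem_set ?mulr1//; split=> //; apply/stopped_atE.
rewrite indicE memNset ?mulr0// => -[/= Xy /stopped_atE].
rewrite -ltnS ltn_ord => /(_ isT) kn.
have kE : k = Ordinal sn by exact: val_inj.
by case/eqP: kyn; rewrite -Xy kE.
Qed.

Lemma expect_sum_indic x (I : finType) (c : I -> R) (A : I -> set Omega) :
  (forall i, measurable (A i)) ->
  expect_from x (fun w => \sum_i c i * \1_(A i) w) = \sum_i c i * pr x (A i).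
Proof.
move=> mA; rewrite /Defs.expect_from unlock.
rewrite (eq_integral (fun w => \sum_i ((c i)%:E * (\1_(A i) w)%:E)%E)); last first.
  by move=> w _; rewrite -sumEFin.
rewrite integral_sum// => [|i]; last first.
  by apply: integrableZl => //; exact: integrable_indic.
rewrite (eq_bigr (fun i => (c i * pr x (A i))%:E)) => [|i _].
  by rewrite sumEFin.
rewrite integralZl//; last exact: integrable_indic.
by rewrite integral_indic// setIT [X in (_ * X)%E]prE.
Qed.

Lemma expect_state x n : expect_from x (fun w => u (X n w)) =
  \sum_y u y * pr x (X n @^-1` [set y]).
Proof.
rewrite -expect_sum_indic => [|y]; last exact: (measurable_state markovX).
congr (expect_from x _); apply/funext => w.
rewrite (bigD1 (X n w))//= big1 => [|y yX].
  by rewrite addr0 indicE mem_set// mulr1.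
by rewrite indicE memNset ?mulr0//= => Xy; rewrite Xy eqxx in yX.
Qed.

(** Term [k] is the mean contribution of stopping at time [k]: survive [k] draws, then stop with
    probability [stop_prob n k]. *)
Let mean_upto n x : R :=
  \sum_(k < n.+1)
    iter k (step (fun z => 1 - p z)) (fun z => stop_prob n k z * u z) x.

Lemma expect_stopped_value_upto x n :
  expect_from x (stopped_value_upto n) = mean_upto n x.
Proof.
rewrite (_ : stopped_value_upto n = fun w => \sum_(ky : 'I_n.+1 * E)
   u ky.2 * \1_(X ky.1 @^-1` [set ky.2] `&` stopped_at n ky.1) w); last first.
  by apply/funext => w; exact: stopped_value_uptoE.
rewrite expect_sum_indic => [|ky]; last exact: measurable_stopped_at.
rewrite -(pair_bigA _ (fun (k : 'I_n.+1) y =>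
  u y * pr x (X k @^-1` [set y] `&` stopped_at n k))) /=.
apply: eq_bigr => k _; under eq_bigr do rewrite pr_stopped_at.
rewrite -iter_step_bigsum; congr (iter _ _ _ x); apply/funext => z.
rewrite (bigD1 z)//= big1 => [|y yz].
  by rewrite addr0 indicE mem_set// mulr1 mulrC.
by rewrite indicE memNset ?mulr0//= => /eqP zy; rewrite eq_sym zy in yz.
Qed.

(** The term [k = 0] is stopping at once; the others share a first step, and [stop_prob] is
    unchanged when both indices rise by one. *)
Lemma mean_uptoS n x :
  mean_upto n.+1 x = p x * u x + step (fun z => 1 - p z) (mean_upto n) x.
Proof.
rewrite [LHS]big_ord_recl; congr (_ + _).
rewrite (_ : mean_upto n = fun z => \sum_(k < n.+1) 1 *
    iter k (step (fun z => 1 - p z)) (fun z => stop_prob n k z * u z) z); last first.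
  by apply/funext => z; apply: eq_bigr => k _; rewrite mul1r.
rewrite -[step _ _ x]/(iter 1 (step _) _ x) iter_step_bigsum; apply: eq_bigr => k _.
by rewrite mul1r /= /stop_prob /bump /= add1n ltnS.
Qed.

Lemma measurable_stopped_value_upto n :
  measurable_fun setT (stopped_value_upto n).
Proof.
rewrite (_ : stopped_value_upto n = fun w => \sum_(ky : 'I_n.+1 * E)
   u ky.2 * \1_(X ky.1 @^-1` [set ky.2] `&` stopped_at n ky.1) w); last first.
  by apply/funext => w; exact: stopped_value_uptoE.
apply: measurable_sum => ky; apply: measurable_funM => //.
by apply: measurable_indic; exact: measurable_stopped_at.
Qed.

(** * Removal of the truncation *)

Lemma cvg_stopped_value_upto w :
  (exists N, forall n, (N <= n)%N ->
    stopped_value_upto n w = stopped_value_upto N w) ->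
  stopped_value_upto n w @[n --> \oo] --> stopped_value X Y u p w.
Proof.
rewrite /stopped_value_upto /stopped_value /stop_upto.
case: stopping_time => [k _|[N NE]].
  apply: cvg_near_cst; near=> n; rewrite (minn_idPl _)//.
  by near: n; exact: nbhs_infty_ge.
suff c : u (X n w) @[n --> \oo] --> u (X N w) by rewrite (cvg_lim _ c).
by apply: cvg_near_cst; near=> n; rewrite NE//; near: n; exact: nbhs_infty_ge.
Unshelve. all: by end_near. Qed.

(** The stopping time must be infinite here, and [u (X n)] has finitely many values; not being
    eventually constant, it diverges, and [limn] returns the default [point]. *)
Lemma dvg_stopped_value_upto w :
  ~ (exists N, forall n, (N <= n)%N ->
    stopped_value_upto n w = stopped_value_upto N w) ->
  stopped_value X Y u p w = point.
Proof.
rewrite /stopped_value_upto /stopped_value /stop_upto.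
case: stopping_time => [k ncst|ncst].
  by case: ncst; exists k => n kn; rewrite (minn_idPl kn) minnn.
by apply: dvgP => /cvgn_finite_range.
Qed.

(** On [G] the value is a pointwise limit of measurable functions; off [G] it is the constant
    [point]. *)
Lemma measurable_stopped_value : measurable_fun setT (stopped_value X Y u p).
Proof.
pose G := [set w | exists N, forall n, (N <= n)%N ->
  stopped_value_upto n w = stopped_value_upto N w].
have mG : measurable G.
  rewrite (_ : G = \bigcup_N \bigcap_(n in [set n | (N <= n)%N])
     ((stopped_value_upto n \- stopped_value_upto N) @^-1` [set 0])).
    apply: bigcup_measurable => N _; apply: bigcap_measurableType => n _.
    rewrite -[_ @^-1` _]setTI; apply: measurable_funB => //.
    - exact: measurable_stopped_value_upto.
    - exact: measurable_stopped_value_upto.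
  apply/seteqP; split => [w [N NE]|w [N _ NE]]; exists N => // n Nn.
    by rewrite /= NE// subrr.
  by apply/eqP; rewrite -subr_eq0; apply/eqP; exact: NE.
rewrite -(setvU G); apply/measurable_funU => //; first exact: measurableC.
split.
  apply: (eq_measurable_fun (cst point)); last exact: measurable_cst.
  by move=> w /set_mem nG; rewrite dvg_stopped_value_upto.
apply: (@measurable_fun_cvg _ _ _ _ stopped_value_upto) => [n|w Gw].
  by apply: measurable_funTS; exact: measurable_stopped_value_upto.
exact: cvg_stopped_value_upto.
Qed.

(** Dominated convergence: almost surely the chain is eventually constant, so the truncated values
    converge, and [B] bounds them all. *)
Lemma cvg_mean_upto x : mean_upto n x @[n --> \oo] --> stopped_mean Pr X Y u p x.
Proof.
pose B := \sum_y `|u y|.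
have uB y : `|u y| <= B by rewrite /B (bigD1 y)//= lerDl sumr_ge0.
have [] := @dominated_convergence _ _ _ (Pr x) setT measurableT
  (fun n => EFin \o stopped_value_upto n) (EFin \o stopped_value X Y u p) (cst B%:E).
- by move=> n; apply/measurable_EFinP; exact: measurable_stopped_value_upto.
- by apply/measurable_EFinP; exact: measurable_stopped_value.
- have := ae_eventually_constant markovX absorbingX x.
  apply: filterS => w [N NE] _; apply: cvg_EFin; first by near=> n.
  apply: cvg_stopped_value_upto.
  rewrite /stopped_value_upto /stop_upto; case: stopping_time => [k|].
    by exists k => n kn; rewrite (minn_idPl kn) minnn.
  by exists N => n Nn; rewrite NE.
- exact: finite_measure_integrable_cst.
- by apply: aeW => w n _; rewrite lee_fin; exact: uB.
move=> iV _ cV; rewrite (_ : mean_upto ^~ x = fun n =>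
    fine (\int[Pr x]_w (EFin \o stopped_value_upto n) w)); last first.
  apply/funext => n; rewrite -expect_stopped_value_upto.
  by rewrite /Defs.expect_from unlock.
rewrite /stopped_mean /Defs.expect_from unlock; apply: fine_cvg.
rewrite fineK//; exact: integrable_fin_num.
Unshelve. all: by end_near. Qed.

(** The recursion for truncated means passes to the limit. *)
Lemma stopped_mean_step x : stopped_mean Pr X Y u p x =
  p x * u x + (1 - p x) * \sum_y trans x y * stopped_mean Pr X Y u p y.
Proof.
have c1 : (fun n => mean_upto n.+1 x) @ \oo --> stopped_mean Pr X Y u p x.
  by rewrite (cvg_shiftS (mean_upto ^~ x)); exact: cvg_mean_upto.
rewrite -(cvg_lim (@norm_hausdorff _ R^o) c1); apply/cvg_lim => //.
rewrite (_ : (fun n => _) = fun n => p x * u x +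
   (1 - p x) * \sum_y trans x y * mean_upto n y); last first.
  by apply/funext => n; exact: mean_uptoS.
apply: cvgD; first exact: cvg_cst.
apply: cvgM; first exact: cvg_cst.
by apply: cvg_sumr => y; apply: cvgM; [exact: cvg_cst|exact: cvg_mean_upto].
Qed.

(** If [p a = 0], the one-step equation at [a] is a tautology; the value comes instead from the
    truncated means, where stopping is forced. *)
Lemma stopped_mean_absorbing a : absorbing_state Pr X a ->
  stopped_mean Pr X Y u p a = u a.
Proof.
move=> absa.
have ma n : mean_upto n a = u a.
  elim: n => [|n IH].
    by rewrite /mean_upto big_ord_recl big_ord0 addr0 /= /stop_prob mul1r.
  rewrite mean_uptoS /weighted_step (bigD1 a)//= IH.
  rewrite trans_absorbing// eqxx mul1r big1.
    by rewrite addr0 -mulrDl addrC subrK mul1r.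
  by move=> z za; rewrite trans_absorbing// (negbTE za) mul0r.
rewrite -(cvg_lim (@norm_hausdorff _ R^o) (cvg_mean_upto (x := a))).
apply/cvg_lim => //; rewrite (_ : (fun n => _) = cst (u a)); first exact: cvg_cst.
by apply/funext => n; exact: ma.
Qed.

(** The bound is uniform in [p], so that limits along an ultrafilter exist; each step of the
    recursion is a convex combination and preserves it. *)
Lemma ler_stopped_mean x : `|stopped_mean Pr X Y u p x| <= \sum_y `|u y|.
Proof.
set B := \sum_y `|u y|.
have uB y : `|u y| <= B by rewrite /B (bigD1 y)//= lerDl sumr_ge0.
have mB n y : `|mean_upto n y| <= B.
  elim: n y => [|n IH] y.
    by rewrite /mean_upto big_ord_recl big_ord0 addr0 /= /stop_prob mul1r.
  have /andP[p0 p1] := p01' y.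
  rewrite mean_uptoS (le_trans (ler_normD _ _))//.
  have -> : B = p y * B + (1 - p y) * B by rewrite -mulrDl addrC subrK mul1r.
  apply: lerD; first by rewrite normrM ger0_norm// ler_wpM2l.
  rewrite /weighted_step normrM (ger0_norm (onem_p_ge0 y)).
  rewrite ler_wpM2l ?onem_p_ge0// (le_trans (ler_norm_sum _ _ _))//.
  rewrite -[leRHS]mul1r -(sum_trans markovX y) mulr_suml; apply: ler_sum => z _.
  by rewrite normrM ger0_norm ?trans_ge0// ler_wpM2l// trans_ge0.
apply: (cvgr_to_le (cvg_norm (cvg_mean_upto (x := x)))); near=> n.
exact: mB.
Unshelve. all: by end_near. Qed.

End StoppedChain.

(** * The fixed point *)

Section UltraFilterLimits.
Context {R : realType} (U : set_system nat) {UU : UltraFilter U}.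

(** Compactness gives a cluster point, and for an ultrafilter it is a limit: if the preimage of a
    neighbourhood were not in [U], that of its complement would be. *)
Lemma ultra_cvg_bounded (v : nat -> R) a b :
  (forall n, a <= v n <= b) -> exists l : R, v n @[n --> U] --> l.
Proof.
move=> vab.
have [|l [_ vl]] := @segment_compact R a b (v n @[n --> U]) _.
  by apply: (@filterE _ U) => n; rewrite /= in_itv /=; exact: vab.
exists l => A lA; have [//|nA] := in_ultra_setVsetC (v @^-1` A) UU.
by have [r [nAr Ar]] := vl (~` A) A nA lA.
Qed.

Lemma ultra_cvg_itv (v : nat -> R) a b (l : R) :
  (forall n, a <= v n <= b) -> v n @[n --> U] --> l -> a <= l <= b.
Proof.
move=> vab vl; apply/andP; split.
  by apply: (cvgr_to_ge vl); apply: filterE => n; have /andP[] := vab n.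
by apply: (cvgr_to_le vl); apply: filterE => n; have /andP[] := vab n.
Qed.

End UltraFilterLimits.

(** * Fixed points of interval-valued maps on a box *)

Section BoxFixedPoint.
Context {R : realType} {E : finType}.
Variable G : (E -> R) -> E -> set R.
Hypothesis G01 : forall p i q, G p i q -> 0 <= q <= 1.
Hypothesis G_neq0 : forall p i, strategy p -> exists q, G p i q.
Hypothesis G_itv : forall p i, strategy p -> is_interval (G p i).
Hypothesis G_closed : forall (U : set_system nat), UltraFilter U ->
  forall (p : nat -> E -> R) (q : nat -> R) (p0 : E -> R) (q0 : R) i,
  (forall n, strategy (p n)) -> strategy p0 -> (forall n, G (p n) i (q n)) ->
  (forall j, p n j @[n --> U] --> p0 j) -> q n @[n --> U] --> q0 -> G p0 i q0.

Let below (b : bool) (q r : R) := if b then q <= r else r <= q.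

Lemma approximate_box_fixed_point m : exists2 p : E -> R, strategy p &
  forall i b, exists p' q, [/\ strategy p', G p' i q, below b q (p' i) &
    forall j, p j <= p' j <= p j + m.+1%:R^-1].
Proof.
(* Capping at [m.+1] turns every [z], even off the grid, into a strategy. *)
pose pt (z : E -> nat) : E -> R := fun j => (minn (z j) m.+1)%:R / m.+1%:R.
have m0 : 0 < m.+1%:R :> R by rewrite ltr0n.
have pt01 z : strategy (pt z).
  move=> j; rewrite /pt divr_ge0 ?ler0n//= ler_pdivrMr// mul1r ler_nat.
  exact: geq_minr.
(* The boundary labels that Kuhn's lemma requires are imposed first; they are consistent with
   [below], since points of [G] lie between 0 and 1. *)
pose a i z := (z i != 0%N) && ((m < z i)%N ||
  ~~ `[< exists2 q, G (pt z) i q & pt z i <= q >]).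
have aP b i z : a i z = b -> exists2 q, G (pt z) i q & below b q (pt z i).
  have [q Gq] := G_neq0 i (pt01 z); have /andP[q0 q1] := G01 Gq.
  rewrite /a; have [z0 <- /=|_ /=] := eqVneq (z i) 0%N.
    by exists q => //; rewrite /pt z0 min0n mul0r.
  have [mz <- /=|_ /=] := ltnP m (z i).
    by exists q => //; rewrite /pt (minn_idPr mz) divff// gt_eqF.
  case: asboolP => [[r Gr rz] <-|nG <-]; first by exists r.
  exists q => //=; rewrite leNgt; apply/negP => qz.
  by apply: nG; exists q => //; exact: ltW.
have [||z zm zP] := @kuhn_cube E m.+1 a.
- by move=> i z zi; rewrite /a zi.
- by move=> i z zi; rewrite /a zi ltnSn.
exists (pt z) => // i b; have [z' zz' az'] := zP i b.
have [q Gq qz] := aP _ _ _ az'; exists (pt z'), q; split=> // j.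
have /andP[zz1 zz2] := zz' j; rewrite /pt -[X in _ <= _ + X]mul1r -mulrDl natr1.
rewrite !ler_pM2r ?invr_gt0// !ler_nat leq_min geq_minr andbT.
rewrite (leq_trans (geq_minl _ _) zz1)/= (minn_idPl (ltnW (zm j))).
exact: leq_trans (geq_minl _ _) zz2.
Qed.

Lemma box_fixed_point : exists2 p : E -> R, strategy p & forall i, G p i (p i).
Proof.
have [p /all_and2[p01 pP]] := choice (fun m =>
  let: ex_intro2 p p01 pP := approximate_box_fixed_point m in
  ex_intro (fun p => strategy p /\ _) p (conj p01 pP)).
have /choice[p' /choice[q pqP]] : forall mib : nat * (E * bool), exists p' q,
    [/\ strategy p', G p' mib.2.1 q, below mib.2.2 q (p' mib.2.1) &
        forall j, p mib.1 j <= p' j <= p mib.1 j + mib.1.+1%:R^-1].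
  by move=> [m [i b]]; exact: pP.
(* One ultrafilter refining [\oo] makes all bounded sequences converge at once, in place of
   successive subsequences. *)
have [U [UU oU]] := ultraFilterLemma (F := \oo) _.
have /choice[p0 pp0] : forall j, exists l : R, p n j @[n --> U] --> l.
  by move=> j; apply: (@ultra_cvg_bounded _ _ _ _ 0 1) => n; exact: p01.
have p001 : strategy p0.
  by move=> j; apply: (ultra_cvg_itv _ (pp0 j)) => n; exact: p01.
exists p0 => // i.
have side b : exists2 r, G p0 i r & below b r (p0 i).
  have p'p0 j : p' (n, (i, b)) j @[n --> U] --> p0 j.
    (* [p'] stays within the mesh of [p], and the mesh tends to zero. *)
    apply: (squeeze_cvgr (f := fun n => p n j) (h := fun n => p n j + harmonic n)).
    - by apply: filterE => n; have [_ _ _] := pqP (n, (i, b)); exact.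
    - exact: pp0.
    - rewrite -[X in _ --> X]addr0; apply: cvgD; first exact: pp0.
      by move=> A /cvg_harmonic; exact: oU.
  have [|r qr] := @ultra_cvg_bounded _ _ UU (fun n => q (n, (i, b))) 0 1.
    by move=> n; have [_ /G01] := pqP (n, (i, b)).
  exists r.
    apply: (@G_closed U UU (fun n => p' (n, (i, b))) (fun n => q (n, (i, b)))) => //.
      by move=> n; have [] := pqP (n, (i, b)).
    by move=> n; have [] := pqP (n, (i, b)).
  have qb n : below b (q (n, (i, b))) (p' (n, (i, b)) i).
    by have [] := pqP (n, (i, b)).
  case: b qb p'p0 qr => /= qb p'p0 qr.
    by apply: (ler_cvg_to qr (p'p0 i)); apply: filterE => n; exact: qb.
  by apply: (ler_cvg_to (p'p0 i) qr); apply: filterE => n; exact: qb.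
have [[r1 Gr1 /= r1p] [r2 Gr2 /= r2p]] := (side true, side false).
by apply: (G_itv p001 Gr1 Gr2); rewrite r1p r2p.
Qed.

End BoxFixedPoint.

(** * Continuity in the strategy and existence of an equilibrium *)

Section Equilibrium.
Context d (Omega : measurableType d) (R : realType) (E : finType).
Variables (Pr : E -> probability Omega R) (X : nat -> Omega -> E).
Variable (Y : nat -> {mfun Omega >-> R}).
Hypothesis markovX : is_markov_chain Pr X.
Hypothesis absorbingX : is_absorbing_chain Pr X.
Hypothesis iidY : forall x, iid_uniform01 (Pr x) Y.
Hypothesis indepXY : forall x,
  independent_sigma (Pr x)
    (sigma_of_process (setT : set (set E)) X)
    (sigma_of_process (measurable : set (set R)) (fun n => Y n)).

Local Notation mean := (stopped_mean Pr X Y).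

Lemma ultra_cvg_stopped_mean (U : set_system nat) {UU : UltraFilter U}
    (p : nat -> E -> R) (p0 u : E -> R) x :
  (forall n, strategy (p n)) -> strategy p0 ->
  (forall j, p n j @[n --> U] --> p0 j) ->
  mean u (p n) x @[n --> U] --> mean u p0 x.
Proof.
move=> p01 p001 pp0.
have /choice[l ml] : forall y, exists l : R, mean u (p n) y @[n --> U] --> l.
  move=> y; apply: (@ultra_cvg_bounded _ _ _ _ (- \sum_y `|u y|) (\sum_y `|u y|)).
  by move=> n; rewrite -ler_norml; exact: ler_stopped_mean.
suff lm y : l y - mean u p0 y = 0 by rewrite -(subr0_eq (lm x)); exact: ml.
move: y; apply: (max_principle markovX absorbingX) => [a absa|y].
  rewrite stopped_mean_absorbing//; apply/eqP; rewrite subr_eq0; apply/eqP.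
  rewrite -(cvg_lim (@norm_hausdorff _ R^o) (ml a)); apply/cvg_lim => //.
  by apply: cvg_near_cst; apply: filterE => n; rewrite stopped_mean_absorbing.
have lE : l y = p0 y * u y + (1 - p0 y) * \sum_z trans Pr X y z * l z.
  rewrite -(cvg_lim (@norm_hausdorff _ R^o) (ml y)); apply/cvg_lim => //.
  rewrite (_ : (fun n => _) = fun n => p n y * u y +
      (1 - p n y) * \sum_z trans Pr X y z * mean u (p n) z); last first.
    by apply/funext => n; exact: stopped_mean_step.
  apply: cvgD; apply: cvgM; [exact: pp0|exact: cvg_cst|..].
    by apply: cvgB; [exact: cvg_cst|exact: pp0].
  by apply: cvg_sumr => z; apply: cvgM; [exact: cvg_cst|exact: ml].
(* The payoff terms cancel in the difference, leaving [1 - p0 y], at most 1, times the transition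
   average of the difference, as the maximum principle asks. *)
rewrite lE stopped_mean_step// opprD addrACA subrr add0r -mulrBr -sumrB.
have /andP[p0y p1y] := p001 y.
rewrite normrM ger0_norm ?subr_ge0// (le_trans (ler_piMl _ _))// ?gerBl//.
rewrite (le_trans (ler_norm_sum _ _ _))//; apply: ler_sum => z _.
by rewrite -mulrBr normrM ger0_norm// trans_ge0.
Qed.

Variables (f h : E -> R) (g : R -> R).
Hypothesis continuous_g : continuous g.

Local Notation K := (K Pr X Y f h g).

Lemma KE x q p : K x q p =
  q * f x + (1 - q) * (\sum_y mean f p y * trans Pr X x y) +
  g (q * h x + (1 - q) * (\sum_y mean h p y * trans Pr X x y)).
Proof. by rewrite /Defs.K !expect_state. Qed.

Lemma ultra_cvg_K (U : set_system nat) {UU : UltraFilter U}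
    (p : nat -> E -> R) (q : nat -> R) (p0 : E -> R) (q0 : R) x :
  (forall n, strategy (p n)) -> strategy p0 ->
  (forall j, p n j @[n --> U] --> p0 j) -> q n @[n --> U] --> q0 ->
  K x (q n) (p n) @[n --> U] --> K x q0 p0.
Proof.
move=> p01 p001 pp0 qq0.
have mix u : (q n * u x + (1 - q n) * (\sum_y mean u (p n) y * trans Pr X x y))
    @[n --> U] --> q0 * u x + (1 - q0) * (\sum_y mean u p0 y * trans Pr X x y).
  apply: cvgD; apply: cvgM => //; [exact: cvg_cst|..].
    by apply: cvgB => //; exact: cvg_cst.
  apply: cvg_sumr => y; apply: cvgM; last exact: cvg_cst.
  exact: ultra_cvg_stopped_mean.
rewrite (_ : (fun n => _) = fun n =>
    q n * f x + (1 - q n) * (\sum_y mean f (p n) y * trans Pr X x y) +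
    g (q n * h x + (1 - q n) * (\sum_y mean h (p n) y * trans Pr X x y))).
  rewrite KE; apply: cvgD; first exact: mix.
  by apply: continuous_cvg; [exact: continuous_g|exact: mix].
by apply/funext => n; exact: KE.
Qed.

Lemma continuous_K x p : continuous (fun q => K x q p).
Proof.
have mix u c : continuous (fun q : R => q * u x + (1 - q) * c : R).
  move=> q; apply: cvgD; apply: cvgM; [exact: cvg_id|exact: cvg_cst|..].
    by apply: cvgB; [exact: cvg_cst|exact: cvg_id].
  exact: cvg_cst.
rewrite (_ : (fun q => _) = fun q =>
  q * f x + (1 - q) * (\sum_y mean f p y * trans Pr X x y) +
  g (q * h x + (1 - q) * (\sum_y mean h p y * trans Pr X x y))).
  move=> q; apply: cvgD; first exact: mix.
  by apply: continuous_cvg; [exact: continuous_g|exact: mix].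
by apply/funext => q; exact: KE.
Qed.

Lemma argmax_K_neq0 x p : exists q, argmax01 (fun q => K x q p) q.
Proof.
have [|q q01 qmax] := @EVT_max R (fun q => K x q p) 0 1 ler01.
  by apply: continuous_subspaceT; exact: continuous_K.
by exists q; split=> [|r r01]; [rewrite in_itv in q01|apply: qmax; rewrite in_itv].
Qed.

Lemma J_K x p : strategy p -> J Pr X Y f h g p x = K x (p x) p.
Proof.
move=> p01; rewrite KE /J /phi /psi.
have mE u : mean u p x =
    p x * u x + (1 - p x) * \sum_y mean u p y * trans Pr X x y.
  by under eq_bigr do rewrite mulrC; exact: stopped_mean_step.
by rewrite (mE f) (mE h).
Qed.

Lemma Gamma_fixed_point :
  (forall p x, strategy p -> is_interval (argmax01 (fun q => K x q p))) ->
  exists p, strategy p /\ Gamma Pr X Y f h g p p.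
Proof.
move=> argmax_itv.
have [||||p p01 pK] := @box_fixed_point R E (fun p x => argmax01 (fun q => K x q p)).
- by move=> p x q [].
- by move=> p x _; exact: argmax_K_neq0.
- exact: argmax_itv.
(* Closed graph: for fixed [r], the inequality [K x r (p n) <= K x (q n) (p n)] passes to the
   limit. *)
- move=> U UU p q p0 q0 x p01 p001 qmax pp0 qq0; split=> [|r r01].
    by apply: (ultra_cvg_itv _ qq0) => n; have [] := qmax n.
  have cr : K x r (p n) @[n --> U] --> K x r p0.
    by apply: ultra_cvg_K => //; exact: cvg_cst.
  have cq : K x (q n) (p n) @[n --> U] --> K x q0 p0 by exact: ultra_cvg_K.
  apply: (ler_cvg_to cr cq).
  by apply: filterE => n; have [_] := qmax n; exact.
by exists p.
Qed.

Lemma fixed_point_equilibrium p :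
  Gamma Pr X Y f h g p p -> equilibrium Pr X Y f h g p.
Proof.
move=> [p01 pK]; split=> // q x q01.
by rewrite J_K//; have [_] := pK x; exact.
Qed.

End Equilibrium.

Theorem theorem4p3 (R : realType) (d : measure_display)
    (Omega : measurableType d) (E : finType)
    (Pr : E -> probability Omega R) (X : nat -> Omega -> E)
    (Y : nat -> {mfun Omega >-> R}) (f h : E -> R) (g : R -> R)
    (markovX : is_markov_chain Pr X)
    (absorbingX : is_absorbing_chain Pr X)
    (iidY : forall x, iid_uniform01 (Pr x) Y)
    (indepXY : forall x,
      independent_sigma (Pr x)
        (sigma_of_process (setT : set (set E)) X)
        (sigma_of_process (measurable : set (set R)) (fun n => Y n)))
    (continuous_g : continuous g)
    (argmax_interval : forall p x, strategy p ->
      is_interval (argmax01 (fun q => K Pr X Y f h g x q p))) :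
  (exists p, strategy p /\ Gamma Pr X Y f h g p p) /\
  (exists p, equilibrium Pr X Y f h g p).
Proof.
have [p [p01 pG]] : exists p, strategy p /\ Gamma Pr X Y f h g p p.
  exact: Gamma_fixed_point.
split; exists p => //; exact: fixed_point_equilibrium.
Qed.
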